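(* Fix $n\geq 1$. Let $\mathcal{B}(\mathbb{Z}^n)$ be a Banach algebra completion of the group ring $\mathbb{C}[\mathbb{Z}^n]$, continuously contained in $C^*(\mathbb{Z}^n)=C(\mathbb{T}^n)$. Let $\{s_1,\dots,s_n\}$ be the canonical basis of $\mathbb{Z}^n$. Assume that, for every $i=1,\dots,n$, the series $$\frac{2}{\pi}\left(1-\sum_{k=1}^\infty\frac{s_i^k+(s_i^* )^k}{4k^2-1}\right)$$ (defining $\tfrac12(2-s_i-s_i^* )^{1/2}$) converges in $\mathcal{B}(\mathbb{Z}^n)$. Then the subalgebra $\mathcal{B}(\mathbb{Z}^n)$ is spectral in $C^*(\mathbb{Z}^n)=C(\mathbb{T}^n)$.
   Context: $\mathbb{C}[\mathbb{Z}^n]$ is the complex group ring of $\mathbb{Z}^n$ (written multiplicatively inside the ring, so $s_i^*=s_i^{-1}$). $C^*(\mathbb{Z}^n)$ is the group $C^*$-algebra, identified with $C(\mathbb{T}^n)$ by Fourier series, $s_j$ corresponding to the function $\exp(2\pi i\theta_j)$ on $\mathbb{T}^n$ (with $\theta_1,\dots,\theta_n$ the angular coordinates). A Banach algebra completion of $\mathbb{C}[\mathbb{Z}^n]$ is a Banach algebra containing $\mathbb{C}[\mathbb{Z}^n]$ as a dense subalgebra; ''continuously contained in $C^*(\mathbb{Z}^n)$'' means that the inclusion of $\mathbb{C}[\mathbb{Z}^n]$ in $C^*(\mathbb{Z}^n)$ extends to a continuous injective homomorphism $\mathcal{B}(\mathbb{Z}^n)\hookrightarrow C^*(\mathbb{Z}^n)$.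 A unital subalgebra $\mathcal{B}$ of a unital $C^*$-algebra $A$ is spectral in $A$ if, for every $x\in\mathcal{B}$ which is invertible in $A$, the inverse $x^{-1}$ belongs to $\mathcal{B}$. *)

(* Defs.v *)
From HB Require Import structures.
From mathcomp Require Import all_boot all_order all_algebra finmap.
From mathcomp Require Import all_classical all_reals all_analysis.
From mathcomp Require Import complex.
(* Importing [monalg] in full would clash with the notations of
   mathcomp-analysis. *)
From mathcomp Require monalg.
Import (canonicals) monalg.

Set Implicit Arguments.
Unset Strict Implicit.
Unset Printing Implicit Defensive.

Import Order.TTheory GRing.Theory Num.Theory.
Import numFieldNormedType.Exports.

Local Open Scope classical_set_scope.
Local Open Scope ring_scope.

HB.instance Definition _ (R : realType) := GRing.ComAlgebra.copy R[i] R[i]^o.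
HB.instance Definition _ (R : realType) := NormedModule.copy R[i] R[i]^o.

(* The multiplication is a field of the mixin: HB does not allow a structure
   defined here to inherit from both [GRing.Algebra] and [NormedModule].  The
   generic ring operations on a Banach algebra are provided just below. *)
HB.mixin Record CompleteNormedModule_isBanachAlgebra (K : numFieldType) A
    & CompleteNormedModule K A := {
  banach_one : A;
  banach_mul : A -> A -> A;
  banach_mulA : associative banach_mul;
  banach_mul1r : left_id banach_one banach_mul;
  banach_mulr1 : right_id banach_one banach_mul;
  banach_mulDl : left_distributive banach_mul +%R;
  banach_mulDr : right_distributive banach_mul +%R;
  banach_one_neq0 : banach_one != 0;
  banach_scaleAl : forall (k : K) (x y : A),
    k *: banach_mul x y = banach_mul (k *: x) y;
  banach_scaleAr : forall (k : K) (x y : A),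
    k *: banach_mul x y = banach_mul x (k *: y);
  banach_normM : forall x y : A, `|banach_mul x y| <= `|x| * `|y|
}.

#[short(type="banachAlgType")]
HB.structure Definition BanachAlgebra (K : numFieldType) :=
  {A of CompleteNormedModule K A & CompleteNormedModule_isBanachAlgebra K A}.

HB.instance Definition _ (K : numFieldType) (A : banachAlgType K) :=
  GRing.Zmodule_isNzRing.Build (BanachAlgebra.sort A)
    (@banach_mulA K A) (@banach_mul1r K A) (@banach_mulr1 K A)
    (@banach_mulDl K A) (@banach_mulDr K A) (@banach_one_neq0 K A).
HB.instance Definition _ (K : numFieldType) (A : banachAlgType K) :=
  GRing.Lmodule_isLalgebra.Build K (BanachAlgebra.sort A) (@banach_scaleAl K A).
HB.instance Definition _ (K : numFieldType) (A : banachAlgType K) :=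
  GRing.Lalgebra_isAlgebra.Build K (BanachAlgebra.sort A) (@banach_scaleAr K A).

(* The group ring K[G] of an abelian group G, written additively: finitely
   supported functions with the convolution product.  The library's algebra
   structure on [monalg.malg] requires a monoid without nontrivial units. *)
Section GroupRing.
Context (K : comNzRingType) (G : zmodType).

Definition group_ring : Type := monalg.malg G K.
HB.instance Definition _ := GRing.Lmodule.copy group_ring (monalg.malg G K).

Implicit Types a b c : group_ring.

Definition gr_monom (k : K) (g : G) : group_ring := monalg.mkmalgU g k.
Definition gr_coef a (g : G) : K := monalg.mcoeff g a.
Definition gr_supp a : {fset G} := monalg.msupp a.

Definition gr_mul a b : group_ring :=
  \sum_(g <- gr_supp a) \sum_(h <- gr_supp b)
     gr_monom (gr_coef a g * gr_coef b h) (g + h).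

Local Notation "<< k *g g >>" := (gr_monom k g).

Let monom0 g : << 0 *g g >> = 0. Proof. exact: monalg.monalgU0. Qed.
Let monomD g k l : << k + l *g g >> = << k *g g >> + << l *g g >>.
Proof. exact: monalg.monalgUD. Qed.

Lemma gr_expand a : a = \sum_(g <- gr_supp a) << gr_coef a g *g g >>.
Proof. exact: monalg.monalgE. Qed.

Let mulw (d1 d2 : {fset G}) a b : (gr_supp a `<=` d1 -> gr_supp b `<=` d2 ->
  gr_mul a b = \sum_(g <- d1) \sum_(h <- d2)
    << gr_coef a g * gr_coef b h *g g + h >>)%fset.
Proof.
move=> le1 le2; rewrite /gr_mul (big_fset_incl _ le1) /=.
  apply/eq_bigr=> k1 _; apply/big_fset_incl => // k _ kb.
  by rewrite [gr_coef b k]monalg.mcoeff_outdom// mulr0 monom0.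
move=> k _ ka; rewrite big1 // => k' _.
by rewrite [gr_coef a k]monalg.mcoeff_outdom// mul0r monom0.
Qed.

Let mulUU k l g h : gr_mul << k *g g >> << l *g h >> = << k * l *g g + h >>.
Proof.
rewrite (mulw monalg.msuppU_le monalg.msuppU_le) !big_seq_fset1.
by rewrite /gr_coef !monalg.mcoeffUU.
Qed.

Let mulC : commutative gr_mul.
Proof.
move=> a b; rewrite /gr_mul exchange_big /=.
by apply: eq_bigr => h _; apply: eq_bigr => g _; rewrite mulrC addrC.
Qed.

Let mulDl : left_distributive gr_mul +%R.
Proof.
move=> a b c.
rewrite [gr_mul a c](mulw (fsubsetUl _ (gr_supp b)) (fsubset_refl _)).
rewrite [gr_mul b c](mulw (fsubsetUr (gr_supp a) _) (fsubset_refl _)).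
rewrite (mulw (monalg.msuppD_le a b) (fsubset_refl _)) -big_split /=.
apply: eq_bigr => g _; rewrite -big_split /=; apply: eq_bigr => h _.
by rewrite [gr_coef (a + b) g]monalg.mcoeffD mulrDl monomD.
Qed.

Let mul0 a : gr_mul 0 a = 0.
Proof. by apply: (@addrI _ (gr_mul 0 a)); rewrite -mulDl !addr0. Qed.

Let mul_suml b (s : {fset G}) (F : G -> group_ring) :
  gr_mul (\sum_(g <- s) F g) b = \sum_(g <- s) gr_mul (F g) b.
Proof. exact: (big_morph (gr_mul^~ b) (fun x y => mulDl x y b) (mul0 b)). Qed.

Let mul_sumr b (s : {fset G}) (F : G -> group_ring) :
  gr_mul b (\sum_(g <- s) F g) = \sum_(g <- s) gr_mul b (F g).
Proof. by rewrite mulC mul_suml; apply: eq_bigr => g _; rewrite mulC. Qed.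

Let mulA : associative gr_mul.
Proof.
move=> a b c; rewrite (gr_expand a) (gr_expand b) (gr_expand c).
rewrite !mul_suml; apply: eq_bigr => g _.
rewrite [LHS]mul_sumr [gr_mul _ (\sum_(h <- gr_supp b) _)]mul_sumr mul_suml.
apply: eq_bigr => h _.
rewrite !mul_sumr; apply: eq_bigr => l _.
by rewrite !mulUU mulrA addrA.
Qed.

Let mul1 : left_id << 1 *g 0 >> gr_mul.
Proof.
move=> a; rewrite [RHS]gr_expand [in LHS](gr_expand a) mul_sumr.
by apply: eq_bigr => g _; rewrite mulUU mul1r add0r.
Qed.

Let one_neq0 : << 1 *g 0 >> != 0.
Proof. by rewrite [_ == _]monalg.monalgU_eq0 oner_eq0. Qed.

HB.instance Definition _ := GRing.Zmodule_isComNzRing.Build group_ring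
  mulA mulC mul1 mulDl one_neq0.

Lemma gr_monomM k l g h : << k *g g >> * << l *g h >> = << k * l *g g + h >>.
Proof. exact: mulUU. Qed.

Lemma gr_scale_monom k l g : k *: << l *g g >> = << k * l *g g >>.
Proof.
apply/monalg.malgP => h; rewrite [LHS]monalg.mcoeffZ !monalg.mcoeffU.
by rewrite mulrnAr.
Qed.

Let scaleAl k a b : k *: (a * b) = (k *: a) * b.
Proof.
rewrite (gr_expand a) [(\sum_(_ <- _) _) * b]mul_suml !scaler_sumr [RHS]mul_suml.
apply: eq_bigr => g _; rewrite (gr_expand b) [LHS](congr1 _ (mul_sumr _ _ _)).
rewrite [RHS]mul_sumr scaler_sumr.
by apply: eq_bigr => h _; rewrite gr_scale_monom !mulUU gr_scale_monom mulrA.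
Qed.

HB.instance Definition _ := GRing.Lmodule_isLalgebra.Build K group_ring scaleAl.
HB.instance Definition _ := GRing.Lalgebra_isComAlgebra.Build K group_ring.

End GroupRing.

Section FunctionAlgebra.
Context (X : pointedType) (K : comNzRingType) (A : algType K).

Let scaleAl (k : K) (f g : X -> A) : k *: (f * g) = (k *: f) * g.
Proof. by apply/funext => x; exact: scalerAl. Qed.

Let scaleAr (k : K) (f g : X -> A) : k *: (f * g) = f * (k *: g).
Proof. by apply/funext => x; exact: scalerAr. Qed.

HB.instance Definition _ := GRing.Lmodule_isLalgebra.Build K (X -> A) scaleAl.
HB.instance Definition _ := GRing.Lalgebra_isAlgebra.Build K (X -> A) scaleAr.

End FunctionAlgebra.

(* The algebra C(X) of continuous complex functions on X. *)
Section ContinuousFunctions.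
Context (R : realType) (X : ptopologicalType).

Definition contfun_pred : {pred X -> R[i]} := [pred f | `[< continuous f >]].

Record contfun : Type :=
  ContFun { contfun_fun :> X -> R[i]; _ : contfun_fun \in contfun_pred }.

HB.instance Definition _ := [isSub for contfun_fun].
HB.instance Definition _ := [Choice of contfun by <:].

Let contfun_subalg : subalg_closed contfun_pred.
Proof.
split=> [|k f g /asboolP cf /asboolP cg|f g /asboolP cf /asboolP cg];
  apply/asboolP => x.
- exact: cvg_cst.
- by apply: cvgD; [apply: cvgZr; exact: cf|exact: cg].
- by apply: cvgM; [exact: cf|exact: cg].
Qed.

HB.instance Definition _ :=
  GRing.isSubalgClosed.Build R[i] (X -> R[i]) contfun_pred contfun_subalg.
HB.instance Definition _ :=
  [SubChoice_isSubAlgebra of contfun by <:].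

Lemma contfun_exprz (f : X -> R[i]) (m : int) :
  (forall x, f x != 0) -> f \in contfun_pred ->
  (fun x => f x ^ m) \in contfun_pred.
Proof.
move=> f0 cf; case: m => k; first by have := rpredX k cf; rewrite exprfctE.
have := rpredX k.+1 cf; rewrite exprfctE => /asboolP cfk.
apply/asboolP => x; apply: cvgV; last exact: cfk.
exact: expf_neq0.
Qed.

(* Uniform convergence; for compact X, the topology of the sup norm. *)
HB.instance Definition _ := Uniform.copy contfun
  (initial_topology (contfun_fun : contfun -> {uniform X -> R[i]})).

End ContinuousFunctions.

(* T^n is the n-fold power of the unit circle of the complex numbers: the point
   with angular coordinates theta_j has coordinates exp(2 pi i theta_j). *)
Section Torus.
Context (R : realType) (n : nat).

Definition circle : set R[i] := [set z | `|z| = 1].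

Definition torus : Type := {ptws 'I_n -> circle}.

Let circle1 : 1 \in circle.
Proof. by rewrite inE /circle /= normr1. Qed.

HB.instance Definition _ := Uniform.copy torus {ptws 'I_n -> circle}.
HB.instance Definition _ :=
  isPointed.Build torus (fun=> exist _ (1 : R[i]) circle1).

Definition torus_coord (z : torus) (j : 'I_n) : R[i] := set_val (z j).

(* The basis element m of Z^n becomes the function
   exp(2 pi i (m_1 theta_1 + ... + m_n theta_n)). *)
Definition fourier_fun (a : group_ring R[i] 'rV[int]_n) (z : torus) : R[i] :=
  \sum_(m <- gr_supp a) gr_coef a m * \prod_(j < n) torus_coord z j ^ m 0 j.

Lemma torus_coord_continuous j : continuous (torus_coord^~ j).
Proof.
move=> z; apply: (@continuous_comp _ _ _ (fun z : torus => z j) set_val).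
  exact: (@proj_continuous _ (fun=> circle) j).
exact: initial_continuous.
Qed.

Lemma torus_coord_neq0 z j : torus_coord z j != 0.
Proof.
rewrite -normr_eq0 /torus_coord; case: (z j) => w /= /set_mem ->.
exact: oner_neq0.
Qed.

Lemma fourier_fun_continuous a : fourier_fun a \in contfun_pred (X := torus).
Proof.
have -> : fourier_fun a = \sum_(m <- gr_supp a) gr_coef a m *:
    \prod_(j < n) (fun z => torus_coord z j ^ m 0 j).
  apply/funext => z; rewrite fct_sumE; apply: eq_bigr => m _.
  by rewrite fct_prodE.
apply: rpred_sum => m _; apply: rpredZ; apply: rpred_prod => j _.
apply: contfun_exprz => [z|]; first exact: torus_coord_neq0.
exact/asboolP/torus_coord_continuous.
Qed.

Definition fourier (a : group_ring R[i] 'rV[int]_n) : contfun R torus :=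
  ContFun (fourier_fun_continuous a).

End Torus.

(* Only the ring structure of the ambient C*-algebra A is involved. *)
Definition spectral (A : nzRingType) (B : set A) :=
  forall x y : A, B x -> x * y = 1 -> y * x = 1 -> B y.

Section SquareRootSeries.
Context (R : realType) (n : nat).

Definition gr_gen (i : 'I_n) : group_ring R[i] 'rV[int]_n :=
  gr_monom 1 (delta_mx 0 i).

(* s_i^* = s_i^-1 *)
Definition gr_gen_star (i : 'I_n) : group_ring R[i] 'rV[int]_n :=
  gr_monom 1 (- delta_mx 0 i).

(* Partial sums, up to k = N, of the series of (2 - s_i - s_i^* )^(1/2) / 2. *)
Definition sqrt_series (i : 'I_n) (N : nat) : group_ring R[i] 'rV[int]_n :=
  (2 / pi)%:C%C *:
    (1 - \sum_(1 <= k < N.+1)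
           (4 * k%:R ^+ 2 - 1)^-1 *: (gr_gen i ^+ k + gr_gen_star i ^+ k)).

End SquareRootSeries.

(* Main.v *)
Require Import Defs.
From HB Require Import structures.
From mathcomp Require Import all_boot all_order all_algebra.
From mathcomp Require Import all_classical all_reals all_analysis.
From mathcomp Require Import complex ring lra.

Set Implicit Arguments.
Unset Strict Implicit.
Unset Printing Implicit Defensive.

Import Order.TTheory GRing.Theory Num.Theory.
Import numFieldNormedType.Exports.

Local Open Scope classical_set_scope.
Local Open Scope ring_scope.

Import ComplexField.Normc.

(** The theorem is Gelfand theory for [B].  The algebra [B] is commutative,
    because it is the closure of a commutative ring.  A noninvertible [b : B]
    lies in a maximal ideal, hence is killed by a character [chi] with
    [|chi x| <= |x|] ([character_of_noninvertible]).  The hypothesis on the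
    series puts every [chi s_i] on the unit circle: the terms of the convergent
    series tend to [0], so with [z = chi s_i] the numbers [z ^ k + z ^ -k] are
    dominated by [4 k ^ 2 - 1], whereas they grow geometrically when [|z| <> 1]
    ([sqrt_series_unimodular]).  So [z = (chi s_1, ..., chi s_n)] is a point of
    the torus, and [chi] agrees with evaluation at [z] on the group ring, hence
    on [B] by density and continuity.  If [phi b] is invertible in the algebra
    of continuous functions, it does not vanish at [z], which contradicts
    [chi b = 0]; so [b] is invertible in [B].

    That a maximal ideal [J] has residue field [R[i]] is the Gelfand-Mazur
    theorem: modulo [J], every element of [B] has nonempty spectrum.  Instead of
    forming the quotient algebra, the proof works in [B] with the
    submultiplicative seminorm [dist J], the distance to [J], and with inverses
    modulo the null elements of this seminorm.  Nonemptiness of the spectrum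
    ([seminorm_spectrum]) is proved without holomorphic functions, by a variant
    of Rickart's averaging argument.  If [b] had empty spectrum, then
    [S l = (1 - l b)^-1] would exist for all [l], and by compactness would be
    Lipschitz on a large disk.  Averaging [S] over the [m]-th roots of unity
    gives [(1 - (l b) ^ m)^-1], which is therefore Lipschitz on that disk with
    the same constant for all [m = 2 ^ k].  But inside the radius of convergence
    of the geometric series this inverse tends to [1] as [m] grows, and outside
    it stays away from [1]: two close radii on either side give a
    contradiction. *)

(** * Submultiplicative seminorms and inverses modulo null elements *)

Lemma normc_ge0 (R : rcfType) (z : R[i]) : 0 <= normc z.
Proof. by case: z => a b; exact: sqrtr_ge0. Qed.

Lemma normcX (R : rcfType) (z : R[i]) j : normc (z ^+ j) = normc z ^+ j.
Proof.
by elim: j => [|j IHj]; rewrite ?expr0 ?normc1// !exprS normcM IHj.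
Qed.

Lemma normc_real (R : rcfType) (r : R) : normc r%:C%C = `|r|.
Proof. by rewrite /= expr0n/= addr0 sqrtr_sqr. Qed.

(** Since [p 1 <= p 1 ^ 2], the condition [1 <= p 1] only excludes the zero
    seminorm. *)
Record alg_seminorm (R : realType) (A : comAlgType R[i]) (p : A -> R) : Prop :=
  AlgSeminorm {
    seminormD : forall x y, p (x + y) <= p x + p y;
    seminormM : forall x y, p (x * y) <= p x * p y;
    seminormZ : forall a x, p (a *: x) = normc a * p x;
    seminorm1 : 1 <= p 1 }.

Section Seminorm.
Context (R : realType) (A : comAlgType R[i]) (p : A -> R).
Context (Hp : alg_seminorm p).

Lemma seminorm0 : p 0 = 0.
Proof. by rewrite -(scale0r 0) seminormZ// normc0 mul0r. Qed.

Lemma seminormN x : p (- x) = p x.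
Proof. by rewrite -scaleN1r seminormZ// normcN normc1 mul1r. Qed.

Lemma seminorm_ge0 x : 0 <= p x.
Proof.
have := seminormD Hp x (- x); rewrite subrr seminorm0 seminormN => h.
lra.
Qed.

Lemma seminormB x y : p (x - y) <= p x + p y.
Proof. by rewrite -(seminormN y); exact: seminormD. Qed.

Lemma seminorm_null x y : p x = 0 -> p (y * x) = 0.
Proof.
move=> px; apply/eqP; rewrite eq_le seminorm_ge0 andbT.
by rewrite (le_trans (seminormM Hp _ _))// px mulr0.
Qed.

Lemma seminorm_leD0 x y : p y = 0 -> p (x + y) <= p x.
Proof. by move=> py; rewrite (le_trans (seminormD Hp _ _))// py addr0. Qed.

Lemma seminorm_nullD x y : p x = 0 -> p y = 0 -> p (x + y) = 0.
Proof.
by move=> px py; apply/eqP; rewrite eq_le seminorm_ge0 -px seminorm_leD0.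
Qed.

(** [c] is an inverse of [x] in the quotient of [A] by the null elements of
    [p]. *)
Definition inverse_mod (x c : A) := p (c * x - 1) = 0.

(** The resolvent identity [c - d = (l - m) b c d], which holds up to a null
    element. *)
Lemma resolvent_le (b c d : A) (l m : R[i]) :
  inverse_mod (1 - l%:A * b) c -> inverse_mod (1 - m%:A * b) d ->
  p (c - d) <= normc (l - m) * (p b * (p c * p d)).
Proof.
move=> hc hd.
have -> : c - d = ((l - m) *: (b * (c * d))) +
  (d * (c * (1 - l%:A * b) - 1) + (- c) * (d * (1 - m%:A * b) - 1)).
  by rewrite -[(l - m) *: _]mulr_algl [(l - m)%:A]scalerBl; ring.
apply: le_trans (seminorm_leD0 _ _) _.
  by apply: seminorm_nullD; exact: seminorm_null.
rewrite seminormZ//; apply: ler_wpM2l; first exact: normc_ge0.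
apply: le_trans (seminormM Hp _ _) _.
by apply: ler_wpM2l; [exact: seminorm_ge0|exact: seminormM].
Qed.

Lemma seminormX_le x m : (0 < m)%N -> p (x ^+ m) <= p x ^+ m.
Proof.
case: m => // m _; elim: m => [|m IHm]; first by rewrite !expr1.
rewrite exprS [leRHS]exprS; apply: le_trans (seminormM Hp _ _) _.
by rewrite ler_wpM2l// seminorm_ge0.
Qed.

Lemma seminorm_alg a x : p (a%:A * x) = normc a * p x.
Proof. by rewrite mulr_algl seminormZ. Qed.

(** Averaging over the two square roots of unity:
    [(1 - y)^-1 + (1 + y)^-1 = 2 (1 - y ^ 2)^-1]. *)
Lemma inverse_mod_sqr (y c d : A) : inverse_mod (1 - y) c ->
  inverse_mod (1 + y) d -> inverse_mod (1 - y ^+ 2) (2^-1 *: (c + d)).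
Proof.
move=> hc hd; rewrite /inverse_mod.
have e2 : 2^-1%:A * 2 = 1 :> A.
  have n2 : 2 != 0 :> R[i] by rewrite pnatr_eq0.
  transitivity ((2^-1 * 2 : R[i])%:A : A); last by rewrite mulVf// scale1r.
  by rewrite mulr_algl -scalerA scaler_nat.
have -> : 2^-1 *: (c + d) * (1 - y ^+ 2) - 1 =
  (2^-1%:A * (1 + y)) * (c * (1 - y) - 1) +
  (2^-1%:A * (1 - y)) * (d * (1 + y) - 1).
  rewrite -[2^-1 *: (c + d)]mulr_algl -[X in _ - X = _]e2; ring.
by apply: seminorm_nullD; exact: seminorm_null.
Qed.

(** The inverse of [1 - (l b) ^ (2 ^ k)] is the mean of [S (w l)] over the
    [2 ^ k]-th roots of unity [w], so it inherits the Lipschitz constant of [S].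
    Doubling the exponent replaces the sum over roots of unity by the mean of
    two values, at [l] and at [z l] where [z ^ (2 ^ k) = -1]. *)
Lemma resolvent_roots (b : A) (M L : R) (S : R[i] -> A) :
  (forall l, inverse_mod (1 - l%:A * b) (S l)) ->
  (forall l m, normc l <= M -> normc m <= M ->
    p (S l - S m) <= L * normc (l - m)) ->
  forall k, exists T : R[i] -> A,
    (forall l, inverse_mod (1 - (l%:A * b) ^+ (2 ^ k)) (T l)) /\
    (forall l m, normc l <= M -> normc m <= M ->
      p (T l - T m) <= L * normc (l - m)).
Proof.
move=> Sinv Slip; elim=> [|k [T [Tinv Tlip]]].
  by exists S; split=> // l; rewrite expn0 expr1.
have k0 : (0 < 2 ^ k)%N by rewrite expn_gt0.
pose z : R[i] := (2 ^ k).-root (-1).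
have zk : z ^+ (2 ^ k) = -1 by rewrite rootCK.
have z1 : normc z = 1.
  have /eqP : normc z ^+ (2 ^ k) = 1.
    by rewrite -normcX zk normcN normc1.
  by rewrite pexpr_eq1 ?normc_ge0 -?lt0n// => /eqP.
exists (fun l => 2^-1 *: (T l + T (z * l))); split=> [l|l m lM mM].
  rewrite expnSr exprM; apply: inverse_mod_sqr; first exact: Tinv.
  have := Tinv (z * l).
  by rewrite -scalerA -scalerAl exprZn zk scaleN1r opprK.
rewrite -scalerBr seminormZ// opprD addrACA.
have := seminormD Hp (T l - T m) (T (z * l) - T (z * m)).
have := Tlip _ _ lM mM.
have := Tlip (z * l) (z * m).
rewrite !normcM -mulrBr normcM z1 !mul1r => /(_ lM mM).
have -> : normc (2^-1 : R[i]) = 2^-1.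
  have n2 : normc (2 : R[i]) = 2.
    by rewrite -(rmorph_nat (real_complex R)) normc_real ger0_norm.
  by rewrite normcV n2.
move=> *; lra.
Qed.

(** If [x] is nearly null then [s] is close to [1], hence so is [t]; and since
    [y = 1 - t^-1], an inverse [t] close to [1] forces [y] to be small. *)
Lemma inverse_mod_far (x y s t : A) :
  inverse_mod (1 - x) s -> inverse_mod (1 - y) t ->
  p x <= (16 * p 1)^-1 -> p (s - t) <= 4^-1 -> p y < 1.
Proof.
move=> hs ht px st.
have p1 := seminorm1 Hp.
have px0 := seminorm_ge0 x; have ps0 := seminorm_ge0 s.
have py0 := seminorm_ge0 y.
have {}px : p x * p 1 <= 16^-1.
  by rewrite -ler_pdivlMr 1?(lt_le_trans _ p1)// -invfM.
have s1 : p (s - 1) <= p s * p x.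
  have -> : s - 1 = s * x + (s * (1 - x) - 1) by ring.
  exact: le_trans (seminorm_leD0 _ hs) (seminormM Hp _ _).
have sp : p s <= p 1 + p s * p x.
  by have := seminormD Hp (s - 1) 1; rewrite subrK; lra.
have t1 : p (t - 1) <= 3 / 8.
  have -> : t - 1 = (s - 1) - (s - t) by ring.
  apply: le_trans (seminormB _ _) _.
  have pspx : p s * p x <= p 1 * p x + p s * p x * p x.
    by rewrite -mulrDl ler_wpM2r.
  nra.
have : p y <= p (t - 1) + p (t - 1) * p y.
  rewrite [leLHS](_ : _ =
      p ((t - 1) - (t - 1) * y + (-1) * (t * (1 - y) - 1)));
    last by congr p; ring.
  apply: le_trans (seminorm_leD0 _ (seminorm_null _ ht)) _.
  by rewrite (le_trans (seminormB _ _))// lerD2l; exact: (seminormM Hp).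
nra.
Qed.
End Seminorm.

(** A locally bounded function is bounded on disks.  Compactness is used for a
    square of [R * R], which contains the disk. *)
Lemma locally_bounded_disk (R : realType) (f : R[i] -> R) (M : R) :
  (forall m : R[i], exists2 e : R, 0 < e &
    exists K, forall l : R[i], normc (l - m) < e -> f l <= K) ->
  exists K, forall l : R[i], normc l <= M -> f l <= K.
Proof.
move=> floc.
have cpt : compact (`[- M, M] `*` `[- M, M] : set (R * R)).
  by apply: compact_setX; exact: segment_compact.
have /compact_near_coveringP/(_ R +oo%R
  (fun K xy => f (xy.1 +i* xy.2)%C <= K)) := cpt.
case.
  case=> x y _ /=.
  have [e e0 [K fK]] := floc (x +i* y)%C.
  have [e2 e20 e2e] : exists2 e2, 0 < e2 & e2 + e2 < e by exists (e / 3); lra.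
  exists (ball (x, y) e2, [set K' | K <= K']); first split => /=.
  - by apply/nbhs_ballP; exists e2.
  - by apply: nbhs_pinfty_ge; rewrite num_real.
  case=> [[x' y'] K'] /= [[/= bx by_] KK']; apply: le_trans KK'; apply: fK.
  apply: le_lt_trans e2e.
  have -> : ((x' +i* y') - (x +i* y) = (x' - x)%:C + 'i * (y' - y)%:C)%C.
    apply/eqP; rewrite eq_complex /=.
    by apply/andP; split; apply/eqP; ring.
  apply: le_trans (le_normcD _ _) _.
  rewrite normcM /= expr0n /= add0r expr1n sqrtr1 mul1r !addr0 !sqrtr_sqr.
  move: bx by_; rewrite -!ball_normE /= => bx by_.
  by rewrite lerD // ltW // distrC.
move=> M0 [_ h].
exists (M0 + 1) => -[x y] /= lM.
apply: (h (M0 + 1) _ (x, y)); first by rewrite ltrDl.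
have sx : `|x| <= M.
  by rewrite -sqrtr_sqr (le_trans _ lM)// ler_wsqrtr// lerDl sqr_ge0.
have sy : `|y| <= M.
  by rewrite -sqrtr_sqr (le_trans _ lM)// ler_wsqrtr// lerDr sqr_ge0.
by split; rewrite /= in_itv /= -ler_norml.
Qed.

(** * Nonempty spectrum *)

(** If every [b - z] were invertible, [1 - l b] would have an inverse [S l] for
    every [l], Lipschitz on disks by the resolvent identity.  The inverses [T l]
    of [1 - (l b) ^ (2 ^ k)] obey the same Lipschitz bound, yet [T l] is
    close to [1] or far from it according to the side of the radius of
    convergence. *)
Theorem seminorm_spectrum (R : realType) (A : comAlgType R[i]) (p : A -> R)
    (Hp : alg_seminorm p) (b : A) :
  exists z : R[i], forall c, ~ inverse_mod p (b - z%:A) c.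
Proof.
apply: contrapT => nospec.
have {nospec}binv z : exists c, inverse_mod p (b - z%:A) c.
  apply: contrapT => nz; apply: nospec; exists z => c cz.
  by apply: nz; exists c.
have p1 := seminorm1 Hp.
have [c0 c0b] : exists c, p (c * b - 1) = 0.
  by have [c] := binv 0; rewrite /inverse_mod scale0r subr0; exists c.
have /choice[S Sinv] : forall l : R[i], exists c,
    inverse_mod p (1 - l%:A * b) c.
  move=> l; have [->|l0] := eqVneq l 0.
    exists 1; rewrite /inverse_mod scale0r mul0r subr0 mulr1 subrr.
    exact: seminorm0.
  have [c cl] := binv l^-1; exists ((- l^-1) *: c).
  rewrite /inverse_mod -[X in p (X - 1)](_ : c * (b - l^-1%:A) = _) //.
  have ll : l^-1%:A * l%:A = 1 :> A.
    by rewrite mulr_algl scalerA mulVf// scale1r.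
  rewrite -[RHS]scalerAl -[RHS]mulr_algl scaleNr.
  rewrite [LHS](_ : _ = c * ((l^-1%:A * l%:A) * b - l^-1%:A)).
    by ring.
  by rewrite ll mul1r.
(* [p c0] bounds the radii [r] for which some power of [r b] has small seminorm,
   and the room of [1] is for the step [d] beyond such a radius. *)
pose M := p c0 + 1.
have [K SK] : exists K, forall l : R[i], normc l <= M -> p (S l) <= K.
  apply: locally_bounded_disk => m.
  (* By the resolvent identity, [p (S l)] is at most twice [p (S m)] as soon as
     [|l - m| p b p (S m) <= 1 / 2]. *)
  have pm0 := seminorm_ge0 Hp (S m); have pb0 := seminorm_ge0 Hp b.
  have D0 : 0 < 2 * (p b * p (S m) + 1) by nra.
  exists (2 * (p b * p (S m) + 1))^-1; first by rewrite invr_gt0.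
  exists (2 * p (S m)) => l /ltW.
  rewrite -[leRHS]div1r ler_pdivlMr// => lm.
  have pl0 := seminorm_ge0 Hp (S l).
  have := resolvent_le Hp (Sinv l) (Sinv m).
  have := seminormD Hp (S l - S m) (S m); rewrite subrK => sl res.
  have nl0 := normc_ge0 (l - m).
  have {}lm : normc (l - m) * (p b * p (S m)) <= 2^-1 by nra.
  have : normc (l - m) * (p b * p (S m)) * p (S l) <= 2^-1 * p (S l).
    exact: ler_wpM2r.
  lra.
have M0 : 0 <= M by rewrite addr_ge0// seminorm_ge0.
have K0 : 0 <= K.
  by rewrite (le_trans (seminorm_ge0 Hp (S 0)))// SK// normc0.
pose L := p b * (K * K).
have L0 : 0 <= L by rewrite !mulr_ge0// seminorm_ge0.
have Slip l m : normc l <= M -> normc m <= M ->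
    p (S l - S m) <= L * normc (l - m).
  move=> lM mM; rewrite (le_trans (resolvent_le Hp (Sinv l) (Sinv m)))//.
  rewrite mulrC ler_wpM2r// ?normc_ge0// ler_wpM2l ?seminorm_ge0//.
  by apply: ler_pM; rewrite ?seminorm_ge0// SK.
(* The radii inside the disk of convergence of the geometric series of [b]:
   since [p] is submultiplicative, one power of seminorm below [1] makes the
   further powers tend to [0]. *)
pose small (r : R) := exists k, p ((r%:C%C%:A * b) ^+ (2 ^ k)) < 1.
have small_lt r : small r -> 0 <= r -> r < p c0.
  move=> [k]; rewrite ltNge => /negP rk r0; rewrite ltNge; apply/negP => cr.
  have k0 : (0 < 2 ^ k)%N by rewrite expn_gt0.
  have e : p ((c0 * b) ^+ (2 ^ k) - 1) = 0.
    by rewrite subrX1 mulrC; exact: seminorm_null.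
  have := seminorm_leD0 Hp ((c0 * b) ^+ (2 ^ k)) (etrans (seminormN Hp _) e).
  rewrite opprB addrC subrK exprMn.
  move=> h; apply: rk; apply: le_trans (le_trans p1 h) _.
  rewrite (le_trans (seminormM Hp _ _))// exprMn.
  rewrite (_ : r%:C%C%:A ^+ (2 ^ k) = (r%:C%C ^+ (2 ^ k))%:A); last first.
    by rewrite exprZn expr1n.
  rewrite seminorm_alg// normcX normc_real ?ger0_norm//.
  rewrite ler_wpM2r ?seminorm_ge0// (le_trans (seminormX_le Hp _ k0))//.
  by apply: lerXn2r => //; rewrite nnegrE ?seminorm_ge0.
have small0 : small 0.
  by exists 0%N; rewrite expn0 expr1 scale0r mul0r seminorm0.
pose d := (4 * (L + 1))^-1.
have d0 : 0 < d by rewrite invr_gt0; lra.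
have Ld : L * d <= 4^-1.
  by rewrite ler_pdivrMr; lra.
have d1 : d <= 1 by rewrite invf_le1; lra.
(* Two radii at distance [d] on either side of the boundary of [small]. *)
have [i si nsi] : exists2 i, small (i%:R * d) & ~ small (i.+1%:R * d).
  apply: contrapT => step.
  have si i : small (i%:R * d).
    elim: i => [|i IHi]; first by rewrite mul0r.
    by apply: contrapT => nsi; apply: step; exists i.
  have := small_lt _ (si (Num.truncn (p c0 / d)).+1)
    (mulr_ge0 (ler0n _ _) (ltW d0)).
  have i0 := ltW (truncnS_gt (p c0 / d)).
  by rewrite ltNge -ler_pdivrMr// i0.
have {}nsi k : 1 <= p (((i.+1%:R * d)%:C%C%:A * b) ^+ (2 ^ k)).
  by rewrite leNgt; apply/negP => nk; apply: nsi; exists k.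
have id0 : 0 <= i%:R * d by rewrite mulr_ge0// ltW.
have iM := small_lt _ si id0.
have [k sk] : exists k,
    p (((i%:R * d)%:C%C%:A * b) ^+ (2 ^ k)) <= (16 * p 1)^-1.
  have [j sj] := si; set x := _ ^+ _ in sj.
  have q0 := seminorm_ge0 Hp x.
  have e0 : 0 < (16 * p 1)^-1 by rewrite invr_gt0; lra.
  have [N _ /(_ _ (leqnn N))/= qN] :
      \forall n \near \oo, p x ^+ n < (16 * p 1)^-1.
    have q1 : `|p x| < 1 by rewrite ger0_norm.
    move/cvgrPdist_lt: (cvg_expr q1) => /(_ _ e0); apply: filterS => n.
    by rewrite sub0r normrN ger0_norm ?exprn_ge0.
  exists (j + N)%N; rewrite expnD exprM -/x.
  have N0 : (0 < 2 ^ N)%N by rewrite expn_gt0.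
  rewrite (le_trans (seminormX_le Hp _ N0))// (le_trans _ (ltW qN))//.
  by apply: ler_wiXn2l => //; [exact: ltW|rewrite ltnW// ltn_expl].
have [T [Tinv Tlip]] := resolvent_roots Hp Sinv Slip k.
have := nsi k; rewrite leNgt => /negP; apply.
apply: (inverse_mod_far Hp (Tinv _) (Tinv _) sk).
apply: le_trans (Tlip _ _ _ _) _.
- by rewrite normc_real ger0_norm// ltW// (lt_le_trans iM)// lerDl.
- rewrite normc_real ger0_norm ?mulr_ge0 ?(ltW d0)//.
  by rewrite -natr1 mulrDl mul1r lerD// ltW.
- rewrite -rmorphB normc_real -mulrBl -natr1 opprD addNKr mulN1r normrN.
  by rewrite (gtr0_norm d0).
Qed.

(** * The norm of a complex Banach algebra *)

Section BanachNorm.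
Context (R : realType) (B : banachAlgType R[i]).
Implicit Types x y : B.

(** The norm is valued in [R[i]]; infima need it as an element of [R]. *)
Definition rnorm x : R := complex.Re `|x|.

Lemma rnormE x : `|x| = (rnorm x)%:C%C.
Proof. by rewrite /rnorm RRe_real// normr_real. Qed.

Lemma rnorm_ge0 x : 0 <= rnorm x.
Proof. by rewrite -lecR -rnormE normr_ge0. Qed.

Lemma rnormN x : rnorm (- x) = rnorm x.
Proof. by rewrite /rnorm normrN. Qed.

Lemma rnormD x y : rnorm (x + y) <= rnorm x + rnorm y.
Proof. by rewrite -lecR rmorphD/= -!rnormE ler_normD. Qed.

Lemma rnormM x y : rnorm (x * y) <= rnorm x * rnorm y.
Proof. by rewrite -lecR rmorphM/= -!rnormE; exact: banach_normM. Qed.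

Lemma rnormZ a x : rnorm (a *: x) = normc a * rnorm x.
Proof.
rewrite /rnorm normrZ rnormE.
by rewrite (_ : _ * _ = (normc a)%:C%C * (rnorm x)%:C%C)// -rmorphM.
Qed.

Lemma rnormX_le x k : rnorm (x ^+ k) <= rnorm 1 * rnorm x ^+ k.
Proof.
elim: k => [|k IHk]; first by rewrite !expr0 mulr1.
rewrite !exprS mulrCA (le_trans (rnormM _ _))//.
by rewrite ler_wpM2l// rnorm_ge0.
Qed.

Lemma rnorm_cvg (u : nat -> B) (l : B) : u @ \oo --> l ->
  forall e : R, 0 < e -> \forall n \near \oo, rnorm (l - u n) < e.
Proof.
move=> /cvgrPdist_lt ul e e0; have /ul : 0 < e%:C%C by rewrite ltcR.
by apply: filterS => n; rewrite rnormE ltcR.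
Qed.

Lemma rnorm_cvg_step (u : nat -> B) (l : B) : u @ \oo --> l ->
  forall e : R, 0 < e ->
  exists K, forall n, (K <= n)%N -> rnorm (u n.+1 - u n) <= e.
Proof.
move=> ul e e0; have [|K _ uK] := rnorm_cvg ul (e := e / 2).
  by rewrite divr_gt0.
exists K => k Kk; rewrite (splitr e).
have -> : u k.+1 - u k = (l - u k) - (l - u k.+1).
  by rewrite opprB [RHS]addrC subrKA.
apply: le_trans (rnormD _ _) _; rewrite rnormN.
by apply: lerD; apply: ltW; apply: uK => //; exact: leqW.
Qed.

(** The Neumann series of powers of [1 - x] converges to the inverse. *)
Lemma invertible_near_one x : rnorm (1 - x) < 1 -> exists y, x * y = 1.
Proof.
move=> x1; pose u := 1 - x; pose q := rnorm u.
have q0 : 0 <= q := rnorm_ge0 u.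
have q1 : `|q| < 1 by rewrite ger0_norm.
have geo : cvgn (series (geometric (rnorm 1) q)).
  by apply/cvg_ex; eexists; exact: cvg_geometric_series.
have : cvgn (series (fun k => u ^+ k)).
  apply/cauchy_cvgP/cauchy_seriesP => e e0.
  have er : e = (complex.Re e)%:C%C by rewrite RRe_real// gtr0_real.
  have re0 : 0 < complex.Re e by rewrite -ltcR -er.
  move/cauchy_cvgP/cauchy_seriesP : geo => /(_ _ re0); apply: filterS => n.
  rewrite er rnormE ltcR; apply: le_lt_trans.
  rewrite ger0_norm;
    last by apply: sumr_ge0 => k _; rewrite mulr_ge0 ?rnorm_ge0 ?exprn_ge0.
  elim/big_ind2 : _ => [||k _].
  - by rewrite /rnorm normr0.
  - move=> a b c d ab cd; exact: le_trans (rnormD _ _) (lerD _ _).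
  - exact: rnormX_le.
move=> /cvg_ex[l /rnorm_cvg ul]; exists l.
apply/eqP; rewrite -subr_eq0 -normr_eq0 rnormE; apply/eqP; congr (_%:C)%C.
apply/eqP; rewrite eq_le rnorm_ge0 andbT; apply/ler_addgt0Pr => e e0.
rewrite add0r.
have d0 : 0 < (rnorm x + 1)^-1 * (e / 2).
  by rewrite mulr_gt0 ?divr_gt0// invr_gt0 ltr_wpDl// rnorm_ge0.
have d1 : 0 < (rnorm 1 + 1)^-1 * (e / 2).
  by rewrite mulr_gt0 ?divr_gt0// invr_gt0 ltr_wpDl// rnorm_ge0.
have /cvgrPdist_lt/(_ _ d1) qn := cvg_expr q1.
have [n [ln un]] := filter_ex (filterI (ul _ d0) qn).
set s := series _ n in ln.
have -> : x * l - 1 = x * (l - s) - u ^+ n.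
  rewrite /s /series/= mulrBr big_mkord.
  have <- : 1 - u ^+ n = x * (\sum_(i < n) u ^+ i).
    by rewrite -opprB subrX1 -mulNr opprB subKr.
  by rewrite opprB addrA addrAC addrK.
apply: le_trans (rnormD _ _) _; rewrite rnormN (splitr e) lerD//.
  apply: le_trans (rnormM _ _) _.
  have := rnorm_ge0 x; have := rnorm_ge0 (l - s).
  move: ln; rewrite ltr_pdivlMl; last by rewrite ltr_wpDl// rnorm_ge0.
  lra.
apply: le_trans (rnormX_le _ _) _.
move: un; rewrite sub0r normrN ger0_norm ?exprn_ge0// -/q.
rewrite ltr_pdivlMl; last by rewrite ltr_wpDl// rnorm_ge0.
have : 0 <= q ^+ n by rewrite exprn_ge0.
lra.
Qed.

End BanachNorm.

(** * Characters of a commutative Banach algebra *)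

(** An alias of [B], so that its commutative structure can depend on the proof
    of commutativity. *)
Definition comm_algebra (K : numFieldType) (B : banachAlgType K)
  of commutative (@GRing.mul B) : Type := B.

Section CommAlgebra.
Context (K : numFieldType) (B : banachAlgType K).
Context (mulC : commutative (@GRing.mul B)).
HB.instance Definition _ := GRing.Algebra.copy (comm_algebra mulC) B.
HB.instance Definition _ :=
  GRing.PzRing_hasCommutativeMul.Build (comm_algebra mulC) mulC.
End CommAlgebra.

Section Characters.
Context (R : realType) (B : banachAlgType R[i]).
Context (mulC : commutative (@GRing.mul B)).
Implicit Types (x y : B) (J : set B).

(** The empty set counts as an ideal, so that the union of any chain of ideals
    is an ideal. *)
Definition ideal J := forall x y c, J x -> J y -> J (x + c * y).

Definition dist J x : R := inf [set rnorm (x - j) | j in J].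

Section Distance.
Context (J : set B) (J0 : J 0) (idealJ : ideal J) (J1 : ~ J 1).

Lemma ideal_add x y : J x -> J y -> J (x + y).
Proof. by move=> Jx Jy; rewrite -[y]mul1r; exact: idealJ. Qed.

Lemma ideal_mull c x : J x -> J (c * x).
Proof. by move=> Jx; rewrite -[_ * _]add0r; exact: idealJ. Qed.

Lemma ideal_opp x : J x -> J (- x).
Proof. by move=> Jx; rewrite -mulN1r; exact: ideal_mull. Qed.

Lemma ideal_scale a x : J x -> J (a *: x).
Proof. by move=> Jx; rewrite -mulr_algl; exact: ideal_mull. Qed.

Lemma dist_le x j : J j -> dist J x <= rnorm (x - j).
Proof.
move=> Jj; apply: ge_inf; last by exists j.
by exists 0 => _ [k _ <-]; exact: rnorm_ge0.
Qed.

Lemma le_dist a x : (forall j, J j -> a <= rnorm (x - j)) -> a <= dist J x.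
Proof.
move=> ax; apply: lb_le_inf; first by exists (rnorm (x - 0)), 0.
by move=> _ [j Jj <-]; exact: ax.
Qed.

Lemma le_Mdist a c x : 0 <= c ->
  (forall j, J j -> a <= c * rnorm (x - j)) -> a <= c * dist J x.
Proof.
rewrite le_eqVlt => /predU1P[<- /(_ _ J0)|c0 ax]; first by rewrite !mul0r.
rewrite mulrC -ler_pdivrMr//; apply: le_dist => j /ax.
by rewrite ler_pdivrMr// mulrC.
Qed.

Lemma dist_ge0 x : 0 <= dist J x.
Proof. by apply: le_dist => j _; exact: rnorm_ge0. Qed.

Lemma distZ_le a x : dist J (a *: x) <= normc a * dist J x.
Proof.
apply: le_Mdist; [exact: normc_ge0|move=> j Jj].
by rewrite -rnormZ scalerBr dist_le//; exact: ideal_scale.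
Qed.

Lemma dist_null x : J x -> dist J x = 0.
Proof.
move=> Jx; apply/eqP; rewrite eq_le dist_ge0 andbT.
by have := dist_le x Jx; rewrite subrr /rnorm normr0.
Qed.

Lemma distD_le x y : dist J (x + y) <= dist J x + dist J y.
Proof.
rewrite -lerBlDl; apply: le_dist => k Jk; rewrite lerBlDl -lerBlDr.
apply: le_dist => j Jj; rewrite lerBlDr; apply: le_trans (rnormD _ _).
by rewrite addrACA -opprD dist_le//; exact: ideal_add.
Qed.

Lemma distM_le x y : dist J (x * y) <= dist J x * dist J y.
Proof.
apply: le_Mdist; [exact: dist_ge0|move=> k Jk].
rewrite mulrC; apply: le_Mdist; [exact: rnorm_ge0|move=> j Jj].
rewrite mulrC; apply: le_trans (rnormM _ _).
have -> : (x - j) * (y - k) = x * y - (y * j + (x - j) * k).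
  by rewrite mulrBr mulrBl [y * j]mulC opprD addrA.
by apply: dist_le; apply: idealJ => //; exact: ideal_mull.
Qed.

Lemma distZ a x : dist J (a *: x) = normc a * dist J x.
Proof.
apply/eqP; rewrite eq_le distZ_le /=.
have [->|a0] := eqVneq a 0; first by rewrite normc0 mul0r dist_ge0.
have na0 : 0 < normc a.
  by rewrite lt_def normc_ge0 andbT; apply: contra a0 => /eqP/eq0_normc ->.
rewrite mulrC -ler_pdivlMr// mulrC -normcV.
by have := distZ_le a^-1 (a *: x); rewrite scalerA mulVf// scale1r.
Qed.

(** A proper ideal has no element near [1], as such elements are invertible by
    completeness of [B]. *)
Lemma dist1_ge1 : 1 <= dist J 1.
Proof.
apply: le_dist => j Jj; rewrite leNgt; apply/negP => j1.
have [y jy] := invertible_near_one j1.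
by apply: J1; rewrite -jy mulC; exact: ideal_mull.
Qed.

Lemma dist_seminorm : alg_seminorm (dist J : comm_algebra mulC -> R).
Proof.
by split; [exact: distD_le|exact: distM_le|exact: distZ|exact: dist1_ge1].
Qed.

(** The ideal generated by [J] and [b - z] is proper, because [b - z] is not
    invertible modulo the elements at distance [0] from [J]. *)
Lemma ideal_spectrum b :
  exists z : R[i], forall j c, J j -> j + c * (b - z%:A) <> 1.
Proof.
have [z zb] := seminorm_spectrum dist_seminorm b.
exists z => j c Jj jc; apply: (zb c).
rewrite /inverse_mod -[X in dist J X](_ : - j = _).
  by apply: dist_null; exact: ideal_opp.
by rewrite -[X in _ - X]jc opprD addrCA subrr addr0.
Qed.
End Distance.

Lemma maximal_ideal x : (forall y, x * y <> 1) -> exists J : set B,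
  [/\ J x, ideal J, ~ J 1 &
      forall I : set B, ideal I -> ~ I 1 -> J `<=` I -> I `<=` J].
Proof.
move=> xinv.
(* The premise of the last clause lets the empty set, which is the union of the
   empty chain, satisfy [P]. *)
pose P J := [/\ ideal J, ~ J 1 & J !=set0 -> J x].
have [|J [[idJ J1 Jx] Jmax]] := @Zorn_bigcup B P.
  move=> F FP totF; split.
  - move=> y z c [I FI Iy] [K FK Kz].
    have [/(_ _ Iy) Ky|/(_ _ Kz) Iz] := totF _ _ FI FK.
      by exists K => //; have [+ _ _] := FP _ FK; exact.
    by exists I => //; have [+ _ _] := FP _ FI; exact.
  - by move=> [I FI I1]; have [_ + _] := FP _ FI; exact.
  - move=> [y [I FI Iy]]; exists I => //.
    by have [_ _] := FP _ FI; apply; exists y.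
have {}Jx : J x.
  apply: contrapT => nJx.
  have J0 : J = set0.
    by apply/eqP; apply: contrapT => /negP/set0P/Jx.
  apply: (Jmax [set x * y | y in setT]).
    rewrite J0; split => // h; have := h x; apply.
    by exists 1 => //; rewrite mulr1.
  split=> [_ _ c [u _ <-] [v _ <-]|[y _]|_].
  - by exists (u + v * c) => //; rewrite mulrDr [c * _]mulC mulrA.
  - exact: xinv.
  - by exists 1; rewrite ?mulr1.
exists J; split=> // I idI I1 JI.
apply: contrapT => nIJ; apply: (Jmax I); first by split.
by split=> // _; exact: JI.
Qed.

(** The Gelfand-Mazur theorem for a maximal ideal [J]: every [b] is congruent
    modulo [J] to a unique scalar [chi b].  The bound is the comparison of [b]
    with [chi b] in the seminorm [dist J]. *)
Theorem character_of_noninvertible x : (forall y, x * y <> 1) ->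
  exists2 chi : {lrmorphism B -> R[i]},
    chi x = 0 & forall b, normc (chi b) <= rnorm b.
Proof.
move=> /maximal_ideal[J [Jx idJ J1 Jmax]].
have J0 : J 0.
  by have := idJ x x (-1) Jx Jx; rewrite mulN1r subrr.
have /choice[chi chiP] : forall b, exists z : R[i], J (b - z%:A).
  move=> b; have [z zb] := ideal_spectrum J0 idJ J1 b; exists z.
  pose I := [set y | exists j c, J j /\ y = j + c * (b - z%:A)].
  apply: (Jmax I).
  - move=> _ _ c [j [d [Jj ->]]] [k [e [Jk ->]]].
    exists (j + c * k), (d + c * e); split; first exact: idJ.
    by rewrite [c * (_ + _)]mulrDr mulrDl addrACA mulrA.
  - by move=> [j [c [Jj]]] /esym; exact: zb.
  - by move=> j Jj; exists j, 0; rewrite mul0r addr0.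
  - by exists 0, 1; rewrite mul1r add0r.
have scalar_eq0 (a : R[i]) : J a%:A -> a = 0.
  move=> Ja; apply/eqP; apply: contrapT => /negP a0; apply: J1.
  by rewrite -(scale1r 1) -(mulVf a0) -scalerA; exact: (ideal_scale J0 idJ).
have chiE b z : J (b - z%:A) -> chi b = z.
  move=> Jz; apply/eqP; rewrite -subr_eq0; apply/eqP/scalar_eq0.
  rewrite scalerBl -[X in J X](_ : (b - z%:A) + (-1) * (b - (chi b)%:A) = _).
    exact: idJ.
  by rewrite mulN1r opprB addrC addrA subrK.
have chiZ : linear chi.
  move=> a u v; apply: chiE.
  rewrite [X in J X](_ : _ = (v - (chi v)%:A) + a%:A * (u - (chi u)%:A)).
    exact: idJ.
  by rewrite mulr_algl scalerBr scalerA scalerDl opprD addrACA addrC.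
have chiM : monoid_morphism chi.
  split=> [|u v]; first by apply: chiE; rewrite scale1r subrr.
  apply: chiE.
  rewrite [X in J X](_ : _ =
      (chi v)%:A * (u - (chi u)%:A) + u * (v - (chi v)%:A)).
    by apply: (idJ) => //; rewrite -[_ * _]add0r; exact: idJ.
  rewrite mulr_algl mulrBr mulr_algr scalerBr scalerA [RHS]addrC.
  by rewrite addrA subrK [chi v * _]mulrC.
pose linchi := GRing.isLinear.Build R[i] B R[i] *%R chi chiZ.
pose mulchi := GRing.isMonoidMorphism.Build B R[i] chi chiM.
pose lrchi : {lrmorphism B -> R[i]} := HB.pack chi linchi mulchi.
exists lrchi => [|b] /=.
  by apply: chiE; rewrite scale0r subr0.
have sem := dist_seminorm J0 idJ J1.
have : normc (chi b) * dist J 1 <= rnorm b.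
  rewrite -(seminormZ sem).
  have := dist_le b J0; rewrite subr0; apply: le_trans.
  have := seminormB sem b (b - (chi b)%:A).
  by rewrite opprB addrC subrK (dist_null J0 (chiP b)) addr0.
apply: le_trans; rewrite ler_peMr ?normc_ge0//.
exact: (seminorm1 sem).
Qed.
End Characters.

(** * Unimodularity from slow growth *)

Lemma expn_beats_square (R : realType) (r : R) (K : nat) : 1 < r ->
  exists2 k, (K <= k)%N & 4 * k%:R ^+ 2 + 1 <= r ^+ k.
Proof.
move=> r1; have r0 : 0 < r by apply: lt_trans r1.
(* [r ^ k = exp (k h)] is at least [(k h) ^ 3 / 6], of cubic growth. *)
pose h := ln r; have h0 : 0 < h by rewrite ln_gt0.
pose k := maxn K (Num.truncn (30 / h ^+ 3)).+1.
exists k; first exact: leq_maxl.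
have k1 : 1 <= k%:R :> R by rewrite ler1n /k leq_max orbT.
have kh : 30 <= k%:R * h ^+ 3.
  rewrite -ler_pdivrMr ?exprn_gt0//.
  by rewrite (le_trans (ltW (truncnS_gt _)))// ler_nat leq_maxr.
rewrite -(lnK r0) -expRM_natl.
have kh0 : 0 <= k%:R * h by rewrite mulr_ge0// ltW.
apply: le_trans (expR_ge1Dxn 2 kh0).
have -> : (3`!)%:R = 6 :> R by [].
have k2 : 30 * k%:R ^+ 2 <= k%:R ^+ 2 * (k%:R * h ^+ 3).
  by rewrite mulrC ler_wpM2l// sqr_ge0.
have -> : (k%:R * h) ^+ 3 = k%:R ^+ 2 * (k%:R * h ^+ 3) by ring.
nra.
Qed.

(** The larger of [|z|] and [|w| = 1 / |z|] would otherwise make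
    [z ^ k + w ^ k] grow geometrically. *)
Lemma norm1_of_slow_growth (R : realType) (z w : R[i]) (K : nat) : z * w = 1 ->
  (forall k, (K <= k)%N -> normc (z ^+ k + w ^+ k) <= 4 * k%:R ^+ 2 - 1) ->
  normc z = 1.
Proof.
wlog zw : z w / normc w <= normc z.
  move=> wl zw1 zwK; have [wz|/ltW zw] := leP (normc w) (normc z).
    exact: (wl z w).
  have w1 : normc w = 1.
    by apply: (wl w z) => // [|k Kk]; [rewrite mulrC|rewrite addrC zwK].
  by have := congr1 (@normc R) zw1; rewrite normcM w1 mulr1 normc1.
move=> zw1 zwK.
have nzw : normc z * normc w = 1 by rewrite -normcM zw1 normc1.
have w0 := normc_ge0 w; have z0 := normc_ge0 z.
have z1 : 1 <= normc z by nra.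
have w1 : normc w <= 1 by nra.
apply/eqP; rewrite eq_le z1 andbT leNgt; apply/negP => {}z1.
have [k Kk kz] := expn_beats_square K z1.
have := zwK k Kk.
have := le_normcD (z ^+ k + w ^+ k) (- w ^+ k).
rewrite addrK normcN !normcX.
have : normc w ^+ k <= 1 by rewrite exprn_ile1.
lra.
Qed.

(** * Density and continuity *)

Lemma dense_eq (T U : topologicalType) (D : set T) (f g : T -> U) :
  hausdorff_space U -> dense D -> continuous f -> continuous g ->
  (forall x, D x -> f x = g x) -> f = g.
Proof.
move=> hU dD cf cg fg; apply/funext => x; apply: hU => V W Vf Wg.
have [y [Vy Wy]] : (interior (f @^-1` V `&` g @^-1` W) `&` D) !=set0.
  apply: dD; last exact: open_interior.
  by exists x; apply: filterI; [exact: cf|exact: cg].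
have [fy gy] := interior_subset Vy.
by exists (f y); split => //; rewrite fg.
Qed.

Section BanachContinuity.
Context (R : realType) (B : banachAlgType R[i]).

Lemma lipschitz_continuous (V : normedModType R[i]) (f : B -> V) (k : R) :
  (forall x y, `|f x - f y| <= k%:C%C * `|x - y|) -> continuous f.
Proof.
move=> fk x; apply/cvgrPdist_lt => e e0.
have k0 : 0 < `|k|%:C%C + 1 :> R[i] by rewrite ltr_wpDl// lecR.
have d0 : 0 < e / (`|k|%:C%C + 1) by rewrite divr_gt0.
move/cvgrPdist_lt: (@cvg_id _ (nbhs x)) => /(_ _ d0).
apply: filterS => y xy; apply: (le_lt_trans (fk x y)).
apply: (@le_lt_trans _ _ ((`|k|%:C%C + 1) * `|x - y|)).
  by rewrite ler_wpM2r// (@le_trans _ _ (`|k|%:C%C))// ?lecR ?ler_norm// lerDl.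
by rewrite mulrC -ltr_pdivlMr.
Qed.

Lemma mull_continuous (c : B) : continuous (fun x : B => c * x).
Proof.
apply: (@lipschitz_continuous _ _ (rnorm c)) => x y.
by rewrite -mulrBr -rnormE; exact: banach_normM.
Qed.

Lemma mulr_continuous (c : B) : continuous (fun x : B => x * c).
Proof.
apply: (@lipschitz_continuous _ _ (rnorm c)) => x y.
by rewrite -mulrBl -rnormE mulrC; exact: banach_normM.
Qed.

(** Commutation passes to limits one factor at a time: first between an element
    of [B] and one of the subring, then between two elements of [B]. *)
Lemma dense_commutative (A : comNzRingType) (i : {rmorphism A -> B}) :
  dense (range (i : A -> B)) -> commutative (@GRing.mul B).
Proof.
move=> di.
have comm_i a x : x * i a = i a * x.
  pose f x := x * i a; pose g x := i a * x.
  suff /(congr1 (@^~ x)) : f = g by [].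
  apply: (dense_eq _ di).
  - exact: norm_hausdorff.
  - exact: mulr_continuous.
  - exact: mull_continuous.
  - by move=> _ [b _ <-]; rewrite /f /g -!rmorphM mulrC.
move=> x y; pose f x := x * y; pose g x := y * x.
suff /(congr1 (@^~ x)) : f = g by [].
apply: (dense_eq _ di).
- exact: norm_hausdorff.
- exact: mulr_continuous.
- exact: mull_continuous.
- by move=> _ [b _ <-]; rewrite /f /g comm_i.
Qed.
End BanachContinuity.

Lemma uniform_eval_continuous (X : choiceType) (V : uniformType) (z : X) :
  continuous (fun h : {uniform X -> V} => h z).
Proof.
move=> h.
have hp : nbhs (h : {uniform X -> V}) `=>` nbhs (h : {ptws X -> V}).
  have := @pointwise_uniform_cvg X V h (nbhs h) (nbhs_filter h).
  by apply.
exact: (cvg_comp _ _ hp (@proj_continuous X (fun=> V) z h)).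
Qed.

Lemma contfun_eval_continuous (R : realType) (X : ptopologicalType) (z : X) :
  continuous (fun f : contfun R X => f z).
Proof.
move=> f.
have fc := @initial_continuous _ {uniform X -> R[i]} (@contfun_fun R X) f.
have zc := @uniform_eval_continuous X R[i] z f.
exact: (cvg_comp _ _ fc zc).
Qed.

(** * Characters of the group ring *)

Section GroupRingCharacters.
Context (R : realType) (n : nat).
Local Notation CZn := (group_ring R[i] 'rV[int]_n).

Lemma prod_of_exponents (f : 'rV[int]_n -> R[i]) (m : 'rV[int]_n) :
  f 0 = 1 -> (forall a b, f (a + b) = f a * f b) ->
  f m = \prod_(j < n) f (delta_mx 0 j) ^ m 0 j.
Proof.
move=> f0 fD.
have fV a : f (- a) = (f a)^-1.
  have ff : f a * f (- a) = 1 by rewrite -fD subrr.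
  have fa0 : f a != 0.
    by apply: contra_eq_neq ff => ->; rewrite mul0r eq_sym oner_eq0.
  by rewrite -[RHS]mulr1 -ff mulKf.
have fX a (k : nat) : f (a *+ k) = f a ^+ k.
  by elim: k => [|k IHk]; rewrite ?mulr0n ?f0// mulrS exprS fD IHk.
rewrite [in LHS](row_sum_delta m) (big_morph f fD f0); apply: eq_bigr => j _.
rewrite -[m 0 j]intz scaler_int intz; case: (m 0 j) => k.
  exact: fX.
by rewrite NegzE mulrNz fV fX -exprnN.
Qed.

Lemma lrmorphism_fourier (f : {lrmorphism CZn -> R[i]}) (z : torus R n) :
  (forall j, f (gr_gen R j) = torus_coord z j) ->
  forall a, f a = fourier_fun a z.
Proof.
move=> fz a; rewrite /fourier_fun [in LHS](gr_expand a) raddf_sum.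
apply: eq_bigr => m _ /=.
rewrite -[gr_coef a m]mulr1 -gr_scale_monom linearZ /= mulr1; congr (_ * _).
rewrite (prod_of_exponents (f := fun m => f (gr_monom 1 m))).
- by apply: eq_bigr => j _; rewrite -fz.
- exact: rmorph1.
- by move=> b c; rewrite -rmorphM gr_monomM mulr1.
Qed.

Lemma sqrt_seriesB (i : 'I_n) (N : nat) :
  sqrt_series R i N.+1 - sqrt_series R i N =
  (- (2 / pi)%:C%C * (4 * N.+1%:R ^+ 2 - 1)^-1) *:
    (gr_gen R i ^+ N.+1 + gr_gen_star R i ^+ N.+1).
Proof.
have sumS (V : zmodType) (F : nat -> V) :
    \sum_(1 <= k < N.+2) F k = \sum_(1 <= k < N.+1) F k + F N.+1.
  by rewrite big_nat_recr.
have subDr (V : zmodType) (a s t : V) : a - (s + t) - (a - s) = - t.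
  by rewrite (opprD s t) addrA [LHS]addrAC subrr add0r.
by rewrite /sqrt_series -scalerBr sumS subDr mulNr scaleNr -scalerA scalerN.
Qed.

Lemma gr_gen_starM (i : 'I_n) : gr_gen R i * gr_gen_star R i = 1.
Proof. by rewrite gr_monomM mulr1 subrr. Qed.
End GroupRingCharacters.

(** The terms of a convergent series tend to [0], and so do their images under
    the contraction [chi]. *)
Lemma sqrt_series_unimodular (R : realType) (n : nat) (B : banachAlgType R[i])
    (iota : {lrmorphism group_ring R[i] 'rV[int]_n -> B})
    (chi : {lrmorphism B -> R[i]}) (i : 'I_n) :
  (forall b, normc (chi b) <= rnorm b) ->
  cvgn (fun N : nat => iota (sqrt_series R i N)) ->
  normc (chi (iota (gr_gen R i))) = 1.
Proof.
move=> chi_le /cvg_ex[l /rnorm_cvg_step ul].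
have pi0 : 0 < 2 / pi :> R by rewrite divr_gt0// pi_gt0.
have [K uK] := ul _ pi0.
apply: (@norm1_of_slow_growth _ _ (chi (iota (gr_gen_star R i))) K.+1).
  by rewrite -!rmorphM gr_gen_starM !rmorph1.
move=> [//|N] KN.
have k0 : 0 < 4 * N.+1%:R ^+ 2 - 1 :> R.
  have : 1 <= N.+1%:R :> R by rewrite ler1n.
  clear; nra.
have := le_trans (chi_le _) (uK N KN).
rewrite /= -raddfB sqrt_seriesB.
have chiX x k : chi (iota (x ^+ k)) = chi (iota x) ^+ k.
  exact: etrans (congr1 chi (rmorphXn iota k x)) (rmorphXn chi k (iota x)).
have -> x y (a : R[i]) k : chi (iota (a *: (x ^+ k + y ^+ k))) =
    a * (chi (iota x) ^+ k + chi (iota y) ^+ k).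
  rewrite linearZ /= linearZ /= (rmorphD iota) (rmorphD chi).
  by congr (_ * (_ + _)); exact: chiX.
have -> : - (2 / pi)%:C%C / (4 * N.+1%:R ^+ 2 - 1) =
    (- (2 / pi) / (4 * N.+1%:R ^+ 2 - 1))%:C%C :> R[i].
  rewrite [RHS]rmorphM fmorphV; congr (_ / _); first by rewrite rmorphN.
  by rewrite rmorphB rmorphM rmorphXn !rmorph_nat rmorph1.
rewrite normcM normc_real normrM normrN normfV (gtr0_norm pi0) (gtr0_norm k0).
by rewrite -mulrA ger_pMr// mulrC ler_pdivrMr// mul1r.
Qed.

(** * The spectral property *)

Theorem lemma6p1 (R : realType) (n : nat) (hn : (1 <= n)%N)
    (B : banachAlgType R[i])
    (iota : {lrmorphism group_ring R[i] 'rV[int]_n -> B})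
    (iota_inj : injective iota)
    (iota_dense : dense (range iota))
    (phi : {lrmorphism B -> contfun R (torus R n)})
    (phi_cont : continuous phi)
    (phi_inj : injective phi)
    (phi_fourier : forall a : group_ring R[i] 'rV[int]_n,
       phi (iota a) = fourier a)
    (series_cvg : forall i : 'I_n,
       cvgn (fun N : nat => iota (sqrt_series R i N))) :
  spectral (range phi).
Proof.
move=> _ y [b _ <-] by1 yb1.
suff [c bc1] : exists c, b * c = 1.
  exists c => //.
  by rewrite -[LHS]mul1r -yb1 -mulrA -rmorphM bc1 rmorph1 mulr1.
apply: contrapT => binv.
have mulC := dense_commutative iota_dense.
have [chi chib chi_le] : exists2 chi : {lrmorphism B -> R[i]},
    chi b = 0 & forall b, normc (chi b) <= rnorm b.
  by apply: character_of_noninvertible => // c bc; apply: binv; exists c.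
pose z : torus R n := fun j => exist _ (chi (iota (gr_gen R j)))
  (mem_set (congr1 (real_complex R)
    (sqrt_series_unimodular chi_le (series_cvg j)))).
have chiE : (chi : B -> R[i]) = (fun c => phi c z).
  apply: (dense_eq _ iota_dense).
  - exact: norm_hausdorff.
  - apply: (@lipschitz_continuous _ _ _ _ 1) => u v.
    rewrite mul1r -raddfB rnormE.
    by have := chi_le (u - v); rewrite -lecR.
  - move=> c; have zc := @contfun_eval_continuous R (torus R n) z (phi c).
    exact: (cvg_comp _ _ (phi_cont c) zc).
  - move=> _ [a _ <-]; rewrite phi_fourier.
    pose f : {lrmorphism _ -> R[i]} := chi \o iota.
    exact: (@lrmorphism_fourier _ _ f z).
have bz : phi b z = 0 by have := congr1 (@^~ b) chiE; rewrite chib.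
have : phi b z * y z = 1 := congr1 (fun f : contfun R (torus R n) => f z) by1.
by rewrite bz mul0r => /esym/eqP; rewrite oner_eq0.
Qed.
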